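(* Let $\theta \in \mathbb{R}$ and consider the planar system $$\dot{x} = y, \qquad \dot{y} = -x(x^2-1)^2 + \theta y (x^2-1)^2 .$$ The equilibrium point $E_0 = (0,0)$ of this system is stable if $\theta < 0$, unstable if $\theta > 0$, and a center if $\theta = 0$.
   Context: All notions refer to the flow of the autonomous planar system of ordinary differential equations in the claim, with $(x,y) \in \mathbb{R}^2$. An equilibrium $p$ is stable (in the sense of Lyapunov) if for every neighborhood $U$ of $p$ there is a neighborhood $V$ of $p$ such that every solution starting in $V$ exists and remains in $U$ for all $t \ge 0$; it is unstable if it is not stable. An equilibrium $p$ is a center if there is $\delta > 0$ such that every solution curve through a point of the deleted neighborhood $\{q : 0 < |q - p| < \delta\}$ is a closed (periodic) orbit with $p$ in its interior. *)

(* Defs.v *)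
From HB Require Import structures.
From mathcomp Require Import all_boot all_order all_algebra.
From mathcomp Require Import all_classical all_reals all_analysis.

Set Implicit Arguments.
Unset Strict Implicit.
Unset Printing Implicit Defensive.

Import Order.TTheory GRing.Theory Num.Theory.
Import numFieldNormedType.Exports.

Local Open Scope classical_set_scope.
Local Open Scope ring_scope.

Section PlanarFlow.
Context {R : realType}.
Implicit Types (F : R * R -> R * R) (p q : R * R) (J : set R) (u : R -> R * R).

Definition equilibrium F p := F p = 0.

(* [u] is a total function, but only its values on the time interval [J]
   matter. *)
Definition solution F q J u :=
  [/\ open J, is_interval J, J 0, u 0 = q &
      forall t, J t -> is_derive t (1 : R) u (F (u t))].

Definition maximal_solution F q J u :=
  solution F q J u /\
  forall K v, solution F q K v -> J `<=` K -> (forall t, J t -> v t = u t) ->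
    K `<=` J.

(* The first conjunct of the conclusion keeps the second one from holding
   vacuously for a field without solutions. *)
Definition stable F p :=
  equilibrium F p /\
  forall U, nbhs p U -> exists2 V, nbhs p V & forall q, V q ->
    (exists J u, maximal_solution F q J u) /\
    (forall J u, maximal_solution F q J u ->
       forall t, 0 <= t -> J t /\ U (u t)).

Definition unstable F p := equilibrium F p /\ ~ stable F p.

Definition periodic_solution J u :=
  [/\ J = setT, exists t, u t != u 0 &
      exists2 T, 0 < T & forall t, u (t + T) = u t].

(* [p] lies in the interior of the closed curve [C] in the sense of the Jordan
   curve theorem, i.e., in a bounded component of its complement.
   [connected_component A p] is empty when [p] is not in [A], so [~ C p] has to
   be required separately. *)
Definition encloses (C : set (R * R)) p :=
  ~ C p /\ bounded_set (connected_component (~` C) p).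

(* The norm of [R * R] is the max norm; being equivalent to the Euclidean one,
   it yields the same notion. *)
Definition center_equilibrium F p :=
  equilibrium F p /\
  exists2 delta : R, 0 < delta & forall q, 0 < `|q - p| < delta ->
    (exists J u, maximal_solution F q J u) /\
    (forall J u, maximal_solution F q J u ->
       periodic_solution J u /\ encloses (range u) p).

Definition system (theta : R) (z : R * R) : R * R :=
  (z.2, - z.1 * (z.1 ^+ 2 - 1) ^+ 2 + theta * z.2 * (z.1 ^+ 2 - 1) ^+ 2).

End PlanarFlow.

(* Main.v *)
Require Import Defs.
From mathcomp Require Import all_boot all_order all_algebra.
From mathcomp Require Import all_classical all_reals all_analysis.
From mathcomp Require Import ring lra.
Import Order.TTheory GRing.Theory Num.Theory.
Import numFieldNormedType.Exports.
Local Open Scope classical_set_scope.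
Local Open Scope ring_scope.
Set Implicit Arguments.
Unset Strict Implicit.
Unset Printing Implicit Defensive.

(* The energy E = y^2/2 + ((x^2 - 1)^3 + 1)/6 satisfies
   dE/dt = theta y^2 (x^2 - 1)^2 along the flow and E >= max(|x|, |y|)^2 / 8.
   For theta <= 0 this traps small orbits, whence global existence and, for
   theta < 0, stability.  For theta > 0 the form W = 2 E - e x y with a small
   e > 0 satisfies W' >= k W near the origin, so no nontrivial orbit starting on
   the y-axis can stay there.  For theta = 0 write 2 E = g(x)^2 + y^2 with a
   smooth injective g: the point (g(x), y) moves on a circle with angular speed
   g'(x), which is bounded below when E <= 1/16, so each small orbit is the whole
   energy level; the component of the origin in the complement of that level lies
   in the bounded sublevel set. *)

(** [stable] and [center_equilibrium] speak of every maximal solution, so exhibiting one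
    well-behaved solution per starting point does not suffice. The bridge is
    [maximal_solution_extends]: for a locally Lipschitz field, a maximal solution extends every
    solution with the same start. What remains is to construct one solution of known behaviour. The
    polynomial field is not globally Lipschitz, so Picard iteration runs on a cut-off field, and the
    energy keeps its solution where the cutoff equals 1. For [theta > 0] the stability hypothesis to
    be refuted supplies the solution itself.

    The level 1/16 serves two purposes. It lies below 1/8, a lower bound for the energy on the
    boundary of the unit box, which leaves room for the cutoff to fade. It also forces
    [x ^+ 2 <= 1 / 2], away from [x = 1] and [x = -1], where the angular speed vanishes.

    For [theta < 0] the dissipation vanishes on [y = 0], but Lyapunov stability only asks that the
    energy not increase, so no invariance argument is required. *)

Section Derivatives.
Context {R : realType}.
Implicit Types (f g : R -> R) (t a b : R).

(** Replaces the directional increment [h *: 1] by [h], so that pairs and time shifts reduce to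
    limits of difference quotients. *)
Lemma is_derive1_cvg (V : normedModType R) (u : R -> V) t (a : V) :
  is_derive t (1 : R) u a <->
  h^-1 *: (u (h + t) - u t) @[h --> 0^'] --> a.
Proof.
have E : (fun h : R => h^-1 *: ((u \o shift t) (h *: (1 : R)) - u t)) =
         (fun h => h^-1 *: (u (h + t) - u t)).
  by apply/funext => h /=; rewrite [h *: 1]mulr1.
split => [[du <-]|ua]; first by rewrite -E.
by split; rewrite /derivable /derive E; [apply/cvg_ex; exists a|exact: cvg_lim].
Qed.

Lemma is_derive_prod (u : R -> R * R) t (a : R * R) :
  is_derive t (1 : R) u a <->
  is_derive t (1 : R) (fun s : R => (u s).1) a.1 /\
  is_derive t (1 : R) (fun s : R => (u s).2) a.2.
Proof.
rewrite !is_derive1_cvg; split => [ua|[u1 u2]].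
  split.
    exact: (cvg_comp _ _ ua (@cvg_fst _ _ (nbhs a.1) (nbhs a.2) _)).
  exact: (cvg_comp _ _ ua (@cvg_snd _ _ (nbhs a.1) (nbhs a.2) _)).
have E : (fun h => h^-1 *: (u (h + t) - u t)) =
    (fun h => (h^-1 *: ((u (h + t)).1 - (u t).1), h^-1 *: ((u (h + t)).2 - (u t).2))).
  by apply/funext => h; rewrite [LHS]surjective_pairing.
by rewrite E [a]surjective_pairing; exact: cvg_pair u1 u2.
Qed.

Lemma is_derive1_continuous (V : normedModType R) (u : R -> V) t (a : V) :
  is_derive t (1 : R) u a -> {for t, continuous u}.
Proof. by case=> /derivable1_diffP/differentiable_continuous. Qed.

Lemma is_derive_near (V : normedModType R) (u v : R -> V) t (a : V) :
  (\forall s \near t, u s = v s) -> is_derive t (1 : R) u a ->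
  is_derive t (1 : R) v a.
Proof. by move=> uv; apply: near_eq_is_derive. Qed.

Lemma is_derive_pointD f g t a b :
  is_derive t (1 : R) f a -> is_derive t (1 : R) g b ->
  is_derive t (1 : R) (fun s : R => f s + g s) (a + b).
Proof. exact: is_deriveD. Qed.

Lemma is_derive_pointB f g t a b :
  is_derive t (1 : R) f a -> is_derive t (1 : R) g b ->
  is_derive t (1 : R) (fun s : R => f s - g s) (a - b).
Proof. exact: is_deriveB. Qed.

Lemma is_derive_pointM f g t a b :
  is_derive t (1 : R) f a -> is_derive t (1 : R) g b ->
  is_derive t (1 : R) (fun s : R => f s * g s) (a * g t + f t * b).
Proof.
move=> df dg; apply: is_derive_eq (is_deriveM df dg) _.
by rewrite addrC; congr (_ + _); rewrite [LHS]mulrC.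
Qed.

Lemma is_derive_pointC t a : is_derive t (1 : R) (fun=> a) 0.
Proof. exact: is_derive_cst. Qed.

Lemma is_derive_pointN f t a :
  is_derive t (1 : R) f a -> is_derive t (1 : R) (fun s : R => - f s) (- a).
Proof. exact: is_deriveN. Qed.

Lemma is_derive_pointX f n t a :
  is_derive t (1 : R) f a ->
  is_derive t (1 : R) (fun s : R => f s ^+ n.+1) (n.+1%:R * f t ^+ n * a).
Proof.
by move=> df; have := is_deriveX n.+1 df; rewrite exprfctE.
Qed.

Lemma is_derive_timeD (V : normedModType R) (u : R -> V) t (r : R) (a : V) :
  is_derive (t + r) (1 : R) u a -> is_derive t (1 : R) (fun s : R => u (s + r)) a.
Proof. by rewrite !is_derive1_cvg; under eq_fun do rewrite addrA. Qed.

Lemma is_derive_timeN f t a :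
  is_derive (- t) (1 : R) f a -> is_derive t (1 : R) (fun s : R => f (- s)) (- a).
Proof.
move=> df; apply: is_derive_eq (is_derive1_comp df (is_deriveN _)) _.
by rewrite mulrN1.
Qed.

Lemma ge0_derive_le (f f' : R -> R) a b : a <= b ->
  (forall t : R, a <= t <= b -> is_derive t (1 : R) f (f' t)) ->
  (forall t : R, a <= t <= b -> 0 <= f' t) -> f a <= f b.
Proof.
move=> ab df f'0.
have [||c] := @MVT_segment _ f f' a b ab.
- by move=> x; rewrite in_itv/= => /andP[ax xb]; apply: df; rewrite !ltW.
- apply: derivable_within_continuous => x; rewrite in_itv/= => xab.
  by have [] := df _ xab.
- rewrite in_itv/= => cab E; rewrite -subr_ge0 E mulr_ge0 ?subr_ge0//.
  exact: f'0.
Qed.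

Lemma derive0_cst (f : R -> R) a b : a <= b ->
  (forall t : R, a <= t <= b -> is_derive t (1 : R) f 0) -> f a = f b.
Proof.
move=> ab df; apply/eqP; rewrite eq_le (@ge0_derive_le f (fun=> 0))//=.
rewrite -lerN2; apply: (@ge0_derive_le (fun s : R => - f s) (fun=> 0)) => // t /df.
by move/is_derive_pointN; rewrite oppr0.
Qed.

Lemma mean_value_bound (f f' h h' : R -> R) :
  f 0 = 0 -> 0 <= h 0 ->
  (forall t : R, is_derive t (1 : R) f (f' t)) ->
  (forall t : R, is_derive t (1 : R) h (h' t)) ->
  forall t : R, 0 <= t -> (forall s : R, 0 <= s <= t -> `|f' s| <= h' s) -> `|f t| <= h t.
Proof.
move=> f0 h0 df dh t t0 fh; rewrite ler_norml; apply/andP; split.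
- rewrite -subr_ge0 opprK.
  apply: (@le_trans _ _ (f 0 + h 0)); first by rewrite f0 add0r.
  apply: (@ge0_derive_le (fun s : R => f s + h s) (fun s : R => f' s + h' s)) => //.
  by move=> s /fh; rewrite ler_norml -subr_ge0 opprK => /andP[].
- rewrite -subr_ge0.
  apply: (@le_trans _ _ (h 0 - f 0)); first by rewrite f0 subr0.
  apply: (@ge0_derive_le (fun s : R => h s - f s) (fun s : R => h' s - f' s)) => //.
  by move=> s /fh; rewrite ler_norml -[f' s <= _]subr_ge0 => /andP[].
Qed.

Lemma is_derive_expR_scale (c t : R) :
  is_derive t (1 : R) (fun s : R => expR (c * s)) (c * expR (c * t)).
Proof.
have d : is_derive t (1 : R) (fun s : R => c * s) c.
  have := is_derive_pointM (is_derive_pointC t c) (is_derive_id t (1 : R)).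
  by rewrite mul0r add0r mulr1.
by rewrite mulrC; exact: is_derive1_comp (is_derive_expR _) d.
Qed.

(** Integrating an exponential of rate [a] divides it by [a]; this gain is what makes Picard
    iteration contract in a weighted norm. Negative times are reduced to positive ones by
    reflection. *)
Lemma exp_mean_value_bound (f f' : R -> R) (A a : R) : 0 <= A -> 0 < a ->
  f 0 = 0 -> (forall t : R, is_derive t (1 : R) f (f' t)) ->
  (forall t : R, `|f' t| <= A * expR (a * `|t|)) ->
  forall t : R, `|f t| <= A / a * expR (a * `|t|).
Proof.
move=> A0 a0 f0 df f'A t.
have d (s : R) : is_derive s (1 : R) (fun s : R => A / a * expR (a * s)) (A * expR (a * s)).
  have := is_derive_pointM (is_derive_pointC s (A / a)) (is_derive_expR_scale a s).
  by rewrite mul0r add0r mulrA divfK ?gt_eqF.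
have p0 : 0 <= A / a * expR (a * 0).
  by rewrite mulr_ge0 ?expR_ge0 ?divr_ge0// ltW.
have [t0|/ltW t0] := leP 0 t.
  rewrite [X in expR (_ * X)]ger0_norm//.
  apply: (mean_value_bound f0 p0 df d t0) => s /andP[s0 _].
  by rewrite -[s in expR (a * s)]ger0_norm.
rewrite [X in expR (_ * X)]ler0_norm//.
have := @mean_value_bound (fun s : R => f (- s)) (fun s : R => - f' (- s)) _ _ _ p0 _ d (- t).
rewrite opprK; apply; rewrite ?oppr0 ?oppr_ge0//.
  by move=> s; exact: is_derive_timeN.
by move=> s /andP[s0 _]; rewrite normrN (le_trans (f'A _))// normrN ger0_norm.
Qed.

Lemma continuous_local_antiderivative f (n : R) : continuous f ->
  exists W : R -> R, W 0 = 0 /\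
    forall t : R, `|t| < n -> is_derive t (1 : R) W (f t).
Proof.
move=> cf.
pose I x := (\int[lebesgue_measure]_(s in `[- n, x]) f s)%R.
exists (fun x => I x - I 0); split; first by rewrite subrr.
move=> t; rewrite ltr_norml => /andP[nt tn].
rewrite -[f t]subr0; apply: is_derive_pointB.
have [||d e] := @continuous_FTC1_closed R f (- n) t n tn _ nt.
- apply: continuous_compact_integrable; first exact: segment_compact.
  exact: continuous_subspaceT.
- exact: cf.
- by split => //; rewrite -derive1E.
Qed.

(** Antiderivatives on growing intervals, all vanishing at 0, agree on overlaps because their
    difference has zero derivative; hence they glue. *)
Lemma continuous_antiderivative f : continuous f ->
  exists W : R -> R, W 0 = 0 /\ forall t : R, is_derive t (1 : R) W (f t).
Proof.
move=> cf.
have [W Wn] := choice (fun n : R => continuous_local_antiderivative n cf).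
have W0 n : W n 0 = 0 by have [] := Wn n.
have dW (n t : R) : `|t| < n -> is_derive t (1 : R) (W n) (f t) by have [_] := Wn n; exact.
have WE (n m t : R) : `|t| < n -> `|t| < m -> W n t = W m t.
  move=> tn tm; apply/eqP; rewrite -subr_eq0; apply/eqP.
  have d (s : R) : `|s| <= `|t| -> is_derive s (1 : R) (fun x => W n x - W m x) 0.
    move=> st; rewrite -(subrr (f s)).
    by apply: is_derive_pointB; apply: dW; exact: le_lt_trans st _.
  have [t0|/ltW t0] := leP 0 t.
    suff : W n 0 - W m 0 = W n t - W m t by rewrite !W0 subrr => <-.
    apply: (@derive0_cst (fun x => W n x - W m x) _ _ t0) => s /andP[s0 st].
    by apply: d; rewrite !ger0_norm.
  suff : W n t - W m t = W n 0 - W m 0 by rewrite !W0 subrr.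
  apply: (@derive0_cst (fun x => W n x - W m x) _ _ t0) => s /andP[s0 st].
  by apply: d; rewrite !ler0_norm// lerN2.
exists (fun t => W (`|t| + 1) t); split => [|t]; first by rewrite W0.
(* The index of the glued function moves with the point, so it is compared near [t] with one fixed
   antiderivative, valid on a unit neighbourhood. *)
apply: (@is_derive_near _ (W (`|t| + 2)) _ t); last by apply: dW; lra.
near=> s.
have : `|t - s| < 1 by near: s; apply: (@cvgr_dist_lt _ _ _ _ _ id t) => //; exact: cvg_id.
move=> ts; have st : `|s| <= `|t| + `|t - s|.
  by have := ler_normD t (s - t); rewrite addrC subrK [`|s - t|]distrC.
by apply: WE; lra.
Unshelve. all: by end_near. Qed.

End Derivatives.

(** * Convergence at geometric rate *)

Section GeometricSequences.
Context {R : realType}.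

Lemma exists_div_exp2_lt (K e : R) : 0 < e -> exists n, K / 2 ^+ n < e.
Proof.
move=> e0; pose n := Num.bound (K / e); exists n.
have Kn : K / e < 2 ^+ n.
  have h : K / e < n%:R.
    have [Ke|Ke] := leP 0 (K / e); first exact: archi_boundP.
    exact: lt_le_trans Ke (ler0n _ _).
  apply: lt_le_trans h _.
  by rewrite -natrX ler_nat ltnW// ltn_expl.
by rewrite ltr_pdivrMr ?exprn_gt0// mulrC -ltr_pdivrMr.
Qed.

Lemma le_div_exp2_eq0 (V : normedModType R) (x : V) (K : R) :
  (forall n, `|x| <= K / 2 ^+ n) -> x = 0.
Proof.
move=> h; apply/eqP; rewrite -normr_le0 leNgt; apply/negP => x0.
have [n] := exists_div_exp2_lt K x0.
by rewrite ltNge h.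
Qed.

(** The radius [2 * K / 2 ^+ n] is the whole tail of the geometric series, so the intervals around
    [x n] are nested; the supremum of their left ends is a limit with the stated rate. *)
Lemma geometric_cvg (x : nat -> R) (K : R) :
  (forall n, `|x n.+1 - x n| <= K / 2 ^+ n) ->
  exists l, forall n, `|x n - l| <= 2 * K / 2 ^+ n.
Proof.
move=> xK.
have K2 n : 2 * K / 2 ^+ n.+1 = K / 2 ^+ n.
  by rewrite exprS invfM mulrACA divff// mul1r.
have K0 n : 0 <= K / 2 ^+ n by exact: le_trans (normr_ge0 _) (xK n).
pose lo n := x n - 2 * K / 2 ^+ n; pose hi n := x n + 2 * K / 2 ^+ n.
have loS n : lo n <= lo n.+1.
  rewrite /lo K2; have := xK n; rewrite ler_norml => /andP[h _].
  by rewrite -[2 * K / _]mulrA; lra.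
have hiS n : hi n.+1 <= hi n.
  rewrite /hi K2; have := xK n; rewrite ler_norml => /andP[_ h].
  by rewrite -[2 * K / _]mulrA; lra.
have lohi n : lo n <= hi n.
  by rewrite /lo /hi -mulrA; have := K0 n; lra.
have loD n k : lo n <= lo (n + k)%N.
  by elim: k => [|k ih]; rewrite ?addn0// addnS (le_trans ih).
have hiD n k : hi (n + k)%N <= hi n.
  by elim: k => [|k ih]; rewrite ?addn0// addnS (le_trans (hiS _)).
have lh n m : lo n <= hi m.
  apply: le_trans (loD n m) _; apply: le_trans (lohi _) _.
  by rewrite addnC; exact: hiD.
have ub m : ubound (range lo) (hi m) by move=> _ [n _ <-]; exact: lh.
exists (sup (range lo)) => n.
have h1 : lo n <= sup (range lo).
  by apply: ub_le_sup; [exists (hi 0%N); exact: ub|exists n].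
have h2 : sup (range lo) <= hi n.
  by apply: ge_sup; [exists (lo 0%N), 0%N|exact: ub].
by rewrite ler_distlC; apply/andP; split; move: h1 h2; rewrite /lo /hi; lra.
Qed.

End GeometricSequences.

(** * Global existence for bounded, globally Lipschitz fields *)

Section PicardLindelof.
Context {R : realType}.
Implicit Types (u v f : R -> R * R) (F : R * R -> R * R).

Lemma norm_prod_le (p : R * R) (c : R) : (`|p| <= c) = (`|p.1| <= c) && (`|p.2| <= c).
Proof. by rewrite prod_normE ge_max. Qed.

Lemma norm_prod_lt (p : R * R) (c : R) : (`|p| < c) = (`|p.1| < c) && (`|p.2| < c).
Proof. by rewrite prod_normE gt_max. Qed.

Lemma continuous_antiderivative_prod f : continuous f ->
  exists W : R -> R * R, W 0 = 0 /\ forall t : R, is_derive t (1 : R) W (f t).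
Proof.
move=> cf.
have [W1 [W10 dW1]] : exists W : R -> R, W 0 = 0 /\
    forall t : R, is_derive t (1 : R) W (f t).1.
  apply: continuous_antiderivative => t.
  exact: (cvg_comp _ _ (cf t) (@cvg_fst _ _ (nbhs (f t).1) (nbhs (f t).2) _)).
have [W2 [W20 dW2]] : exists W : R -> R, W 0 = 0 /\
    forall t : R, is_derive t (1 : R) W (f t).2.
  apply: continuous_antiderivative => t.
  exact: (cvg_comp _ _ (cf t) (@cvg_snd _ _ (nbhs (f t).1) (nbhs (f t).2) _)).
exists (fun t => (W1 t, W2 t)); split; first by rewrite W10 W20.
by move=> t; apply/is_derive_prod; split; [exact: dW1|exact: dW2].
Qed.

Lemma is_derive_prodB u v (t : R) (a b : R * R) :
  is_derive t (1 : R) u a -> is_derive t (1 : R) v b ->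
  is_derive t (1 : R) (fun s => u s - v s) (a - b).
Proof. exact: is_deriveB. Qed.

Lemma exp_mean_value_bound_prod f (f' : R -> R * R) (A a : R) : 0 <= A -> 0 < a ->
  f 0 = 0 -> (forall t : R, is_derive t (1 : R) f (f' t)) ->
  (forall t : R, `|f' t| <= A * expR (a * `|t|)) ->
  forall t : R, `|f t| <= A / a * expR (a * `|t|).
Proof.
move=> A0 a0 f0 df f'A t; rewrite norm_prod_le; apply/andP; split.
- apply: (exp_mean_value_bound (f := fun t => (f t).1) (f' := fun t => (f' t).1)) => //.
  + by rewrite f0.
  + by move=> s; have /is_derive_prod[] := df s.
  + by move=> s; have := f'A s; rewrite norm_prod_le => /andP[].
- apply: (exp_mean_value_bound (f := fun t => (f t).2) (f' := fun t => (f' t).2)) => //.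
  + by rewrite f0.
  + by move=> s; have /is_derive_prod[] := df s.
  + by move=> s; have := f'A s; rewrite norm_prod_le => /andP[].
Qed.

Lemma geometric_cvg_prod (x : nat -> R * R) (K : R) :
  (forall n, `|x n.+1 - x n| <= K / 2 ^+ n) ->
  exists l, forall n, `|x n - l| <= 2 * K / 2 ^+ n.
Proof.
move=> xK.
have [l1 h1] : exists l, forall n, `|(x n).1 - l| <= 2 * K / 2 ^+ n.
  by apply: geometric_cvg => n; have := xK n; rewrite norm_prod_le => /andP[].
have [l2 h2] : exists l, forall n, `|(x n).2 - l| <= 2 * K / 2 ^+ n.
  by apply: geometric_cvg => n; have := xK n; rewrite norm_prod_le => /andP[].
by exists (l1, l2) => n; rewrite norm_prod_le h1 h2.
Qed.

Lemma near_dist_lt (V : normedModType R) (p : V) (e : R) : 0 < e ->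
  \forall q \near p, `|p - q| < e.
Proof. by move=> e0; exact: (cvgr_dist_lt _ _ (@cvg_id _ (nbhs p)) _ e0). Qed.

Lemma lipschitz_cvg F (L : R) (p : R * R) :
  (forall p q, `|F p - F q| <= L * `|p - q|) -> {for p, continuous F}.
Proof.
move=> FL; apply/cvgrPdist_lt => e e0; near=> q.
apply: le_lt_trans (FL _ _) _.
have L1 : 0 < `|L| + 1 by rewrite ltr_pwDr.
have : `|p - q| < e / (`|L| + 1).
  by near: q; apply: (@near_dist_lt (R * R)%type p); exact: divr_gt0.
rewrite ltr_pdivlMr// mulrC => h; apply: le_lt_trans h.
apply: ler_wpM2r => //; have := ler_norm L; lra.
Unshelve. all: by end_near. Qed.

(* With the weight [expR (2 L |t|)] each Picard iteration halves the distance on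
   the whole line, so no gluing of local solutions is needed. *)
Lemma lipschitz_global_solution F (L B : R) (q : R * R) : 0 < L ->
  (forall p q, `|F p - F q| <= L * `|p - q|) -> (forall p, `|F p| <= B) ->
  exists u, u 0 = q /\ forall t : R, is_derive t (1 : R) u (F (u t)).
Proof.
move=> L0 FL FB.
(* Stated for all [f], with a dummy value for discontinuous ones, so that [choice] yields a total
   operator that can be iterated. *)
have antider f : exists W : R -> R * R, continuous f -> W 0 = 0 /\
    forall t : R, is_derive t (1 : R) W (f t).
  have [cf|ncf] := pselect (continuous f); last by exists (fun=> 0) => /ncf.
  by have [W WP] := continuous_antiderivative_prod cf; exists W.
have [I IP] := choice antider.
pose T u : R -> R * R := fun t => I (F \o u) t + q.
pose x n := iter n T (fun=> q).
have cF u : continuous u -> continuous (F \o u).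
  move=> cu t; apply: continuous_comp; first exact: cu.
  exact: lipschitz_cvg FL.
have T0 u : continuous u -> T u 0 = q.
  by move=> /cF/IP[I0 _]; rewrite /T I0 add0r.
have dT u : continuous u -> forall t : R, is_derive t (1 : R) (T u) (F (u t)).
  move=> /cF/IP[_ dI] t; rewrite -[F (u t)]addr0.
  by apply: is_deriveD; exact: is_derive_cst.
have cT u : continuous u -> continuous (T u).
  by move=> cu t; exact: is_derive1_continuous (dT _ cu t).
have cx n : continuous (x n).
  by elim: n => [|n ih]; [move=> t; exact: cvg_cst|exact: cT].
have x0 n : x n.+1 0 = q := T0 _ (cx n).
have dx n (t : R) : is_derive t (1 : R) (x n.+1) (F (x n t)) := dT _ (cx n) t.
have a0 : 0 < 2 * L by rewrite mulr_gt0.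
have B0 : 0 <= B by exact: le_trans (normr_ge0 _) (FB q).
pose C := B / (2 * L); pose E (t : R) := expR (2 * L * `|t|).
have C0 : 0 <= C by rewrite divr_ge0// ltW.
have E1 t : 1 <= E t.
  by rewrite /E -[leLHS]expR0 ler_expR mulr_ge0// ltW.
have xS n t : `|x n.+1 t - x n t| <= C / 2 ^+ n * E t.
  elim: n t => [|n ih].
    rewrite expr0 divr1.
    apply: (@exp_mean_value_bound_prod _ (fun t => F q - 0)) => //.
    - by rewrite x0 subrr.
    - move=> s; rewrite subr0; apply: le_trans (FB _) _.
      by rewrite ler_peMr// E1.
  have -> : C / 2 ^+ n.+1 = L * (C / 2 ^+ n) / (2 * L).
    have := gt_eqF L0 => L0'; rewrite exprS; field.
    by rewrite L0' expf_neq0.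
  apply: (@exp_mean_value_bound_prod _ (fun t => F (x n.+1 t) - F (x n t))) => //.
  - by rewrite mulr_ge0 ?(ltW L0)// divr_ge0// exprn_ge0.
  - by rewrite !x0 subrr.
  - move=> s; apply: le_trans (FL _ _) _; rewrite -mulrA ler_wpM2l ?(ltW L0)//.
have lim_x t : exists l : R * R, forall n, `|x n t - l| <= 2 * (C * E t) / 2 ^+ n.
  by apply: geometric_cvg_prod => n; rewrite mulrAC; exact: xS.
have [u xu] := choice lim_x.
have cu : continuous u.
  move=> t; apply/cvgrPdist_lt => e e0.
  (* The weight at [|t| + 1] dominates the weight at every [s] within distance 1 of [t], so one [n]
     serves a whole neighbourhood: convergence is locally uniform. *)
  have [n nP] := exists_div_exp2_lt (2 * (C * expR (2 * L * (`|t| + 1))))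
    (divr_gt0 e0 (ltr0Sn _ 2) : 0 < e / 3).
  have near_E s : `|t - s| < 1 -> `|x n s - u s| < e / 3.
    move=> ts; apply: le_lt_trans (xu _ _) (le_lt_trans _ nP).
    rewrite ler_wpM2r ?invr_ge0 ?exprn_ge0// ler_wpM2l// ler_wpM2l//.
    rewrite ler_expR ler_wpM2l ?ltW//.
    have := ler_normD t (s - t); rewrite addrC subrK [`|s - t|]distrC.
    by move: ts; lra.
  near=> s.
  have h1 : `|x n t - u t| < e / 3 by apply: near_E; rewrite subrr normr0.
  have h2 : `|x n s - u s| < e / 3.
    apply: near_E; near: s.
    exact: (@near_dist_lt R t).
  have h3 : `|x n t - x n s| < e / 3.
    near: s; apply: (@cvgr_dist_lt _ _ _ _ _ (x n) (x n t)); first exact: cx.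
    by rewrite divr_gt0.
  have -> : u t - u s = (u t - x n t) + (x n t - x n s) + (x n s - u s).
    by rewrite !subrKA.
  apply: le_lt_trans (ler_normD _ _) _.
  have := ler_normD (u t - x n t) (x n t - x n s).
  rewrite [`|u t - x n t|]distrC; lra.
suff uT t : u t = T u t.
  exists u; split; first by rewrite uT T0.
  move=> t; have -> : u = T u by exact/funext.
  by rewrite -[in X in is_derive _ _ _ X](_ : u = T u);
    [exact: dT|exact/funext].
apply/eqP; rewrite -subr_eq0; apply/eqP.
(* Passing through [x n.+1 = T (x n)], both distances are at most [C * E t / 2 ^+ n]: the first by
   the rate of convergence, the second because [T] halves weighted distances. *)
apply: (@le_div_exp2_eq0 _ _ _ (2 * (C * E t))) => n.
have h1 : `|u t - x n.+1 t| <= C * E t / 2 ^+ n.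
  rewrite distrC; apply: le_trans (xu _ _) _.
  by rewrite exprS invfM mulrACA divff// mul1r.
have h2 : `|x n.+1 t - T u t| <= C * E t / 2 ^+ n.
  have -> : C * E t / 2 ^+ n = L * (2 * C / 2 ^+ n) / (2 * L) * E t.
    have := gt_eqF L0 => L0'; field.
    by rewrite L0' expf_neq0.
  apply: (@exp_mean_value_bound_prod (fun t => x n.+1 t - T u t)
    (fun t => F (x n t) - F (u t))) => //.
  - by rewrite mulr_ge0 ?(ltW L0)// divr_ge0 ?exprn_ge0// mulr_ge0.
  - by rewrite x0 T0 ?subrr.
  - by move=> s; apply: is_derive_prodB; exact: dT.
  - move=> s; apply: le_trans (FL _ _) _; rewrite -mulrA ler_wpM2l ?(ltW L0)//.
    by apply: le_trans (xu _ _) _; rewrite mulrA mulrAC.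
have -> : u t - T u t = (u t - x n.+1 t) + (x n.+1 t - T u t) by rewrite subrKA.
apply: le_trans (ler_normD _ _) _.
by rewrite -[2 * _ / _]mulrA; lra.
Unshelve. all: by end_near. Qed.

End PicardLindelof.

(** * Uniqueness and maximal solutions *)

Section Uniqueness.
Context {R : realType}.
Implicit Types (u v : R -> R * R) (F : R * R -> R * R) (J K : set R).

(** Formulated on whole balls rather than near each point, so that two bounded trajectories share a
    single constant without a covering argument. *)
Definition locally_lipschitz (V : normedModType R) (F : R * R -> V) :=
  forall M : R, exists L : R, forall p q : R * R,
  `|p| <= M -> `|q| <= M -> `|F p - F q| <= L * `|p - q|.

Lemma is_derive_mul_expR (f : R -> R) (k t a : R) : is_derive t (1 : R) f a ->
  is_derive t (1 : R) (fun s : R => f s * expR (k * s)) ((a + k * f t) * expR (k * t)).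
Proof.
move=> df; have := is_derive_pointM df (is_derive_expR_scale k t).
by rewrite mulrDl; congr (is_derive _ _ _ (_ + _)); ring.
Qed.

(** The product of [D] and [expR (- k * t)] is nonincreasing. The backward twin uses [expR (k * t)];
    the pair covers both sides of the initial time. *)
Lemma gronwall_forward (D D' : R -> R) (k a b : R) : a <= b ->
  (forall t : R, a <= t <= b -> is_derive t (1 : R) D (D' t)) ->
  (forall t : R, a <= t <= b -> D' t <= k * D t) ->
  D a = 0 -> D b <= 0.
Proof.
move=> ab dD Dk Da.
rewrite -(pmulr_lle0 _ (expR_gt0 (- k * b))) -[leRHS](mul0r (expR (- k * a))) -Da.
rewrite -lerN2.
apply: (@ge0_derive_le R (fun s : R => - (D s * expR (- k * s)))
  (fun s : R => - ((D' s + - k * D s) * expR (- k * s)))) => // t tab.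
- by apply: is_derive_pointN; apply: is_derive_mul_expR; exact: dD.
- by rewrite -mulNr mulr_ge0 ?expR_ge0// oppr_ge0 mulNr subr_le0; exact: Dk.
Qed.

Lemma gronwall_backward (D D' : R -> R) (k a b : R) : a <= b ->
  (forall t : R, a <= t <= b -> is_derive t (1 : R) D (D' t)) ->
  (forall t : R, a <= t <= b -> - (k * D t) <= D' t) ->
  D b = 0 -> D a <= 0.
Proof.
move=> ab dD Dk Db.
rewrite -(pmulr_lle0 _ (expR_gt0 (k * a))) -[leRHS](mul0r (expR (k * b))) -Db.
apply: (@ge0_derive_le R (fun s : R => D s * expR (k * s))
  (fun s : R => (D' s + k * D s) * expR (k * s))) => // t tab.
- by apply: is_derive_mul_expR; exact: dD.
- by rewrite mulr_ge0 ?expR_ge0// -lerBlDr sub0r; exact: Dk.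
Qed.

Lemma derivable_prod_bounded u (u' : R -> R * R) (a b : R) : a <= b ->
  (forall t : R, a <= t <= b -> is_derive t (1 : R) u (u' t)) ->
  exists M, forall t : R, a <= t <= b -> `|u t| <= M.
Proof.
move=> ab du.
have [|c _ h] := @EVT_max R (fun t => `|u t|) a b ab.
  apply: continuous_in_subspaceT => t; rewrite inE/= in_itv/= => tab.
  by apply: cvg_norm; exact: is_derive1_continuous (du t tab).
by exists `|u c| => t tab; apply: h; rewrite in_itv.
Qed.

(** Agreement may be given at either end, so that it spreads from time 0 into the future and into
    the past. *)
Lemma agree_on_segment F u v (a b : R) : locally_lipschitz F -> a <= b ->
  (forall t : R, a <= t <= b -> is_derive t (1 : R) u (F (u t))) ->
  (forall t : R, a <= t <= b -> is_derive t (1 : R) v (F (v t))) ->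
  u a = v a \/ u b = v b -> u a = v a /\ u b = v b.
Proof.
move=> llF ab du dv uv.
have [M1 uM] := derivable_prod_bounded ab du.
have [M2 vM] := derivable_prod_bounded ab dv.
have [L0 FL] := llF (Num.max M1 M2).
pose L : R := `|L0|.
have L_ge0 : 0 <= L by exact: normr_ge0.
(* The squared Euclidean distance is differentiable, unlike the max norm. *)
pose D (t : R) := ((u t).1 - (v t).1) ^+ 2 + ((u t).2 - (v t).2) ^+ 2.
pose D' (t : R) := 2%:R * ((u t).1 - (v t).1) ^+ 1 * ((F (u t)).1 - (F (v t)).1) +
  2%:R * ((u t).2 - (v t).2) ^+ 1 * ((F (u t)).2 - (F (v t)).2).
have D0 t : 0 <= D t by rewrite addr_ge0 ?sqr_ge0.
have Duv t : D t <= 0 -> u t = v t.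
  move=> Dt; have := sqr_ge0 ((u t).1 - (v t).1); have := sqr_ge0 ((u t).2 - (v t).2).
  rewrite /D in Dt => h1 h2.
  have /eqP : ((u t).1 - (v t).1) ^+ 2 = 0 by lra.
  have /eqP : ((u t).2 - (v t).2) ^+ 2 = 0 by lra.
  rewrite !sqrf_eq0 !subr_eq0 => /eqP e2 /eqP e1.
  by rewrite (surjective_pairing (u t)) e1 e2 -surjective_pairing.
have uvD t : u t = v t -> D t = 0 by rewrite /D => ->; rewrite !subrr expr0n addr0.
have dD t : a <= t <= b -> is_derive t (1 : R) D (D' t).
  move=> tab; have /is_derive_prod[du1 du2] := du t tab.
  have /is_derive_prod[dv1 dv2] := dv t tab.
  by apply: is_derive_pointD; apply: is_derive_pointX; apply: is_derive_pointB.
(* Each of the two coordinates contributes at most [2 * m * (L * m)], and [m ^+ 2 <= D t]. *)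
have DL t : a <= t <= b -> `|D' t| <= 4 * L * D t.
  move=> tab; set m := `|u t - v t|.
  have m0 : 0 <= m by exact: normr_ge0.
  have Fm : `|F (u t) - F (v t)| <= L * m.
    apply: le_trans (FL _ _ _ _) _; rewrite ?le_max ?uM ?vM ?orbT//.
    by apply: ler_wpM2r => //; exact: ler_norm.
  move: Fm; rewrite norm_prod_le/= => /andP[F1 F2].
  have : `|u t - v t| <= m by [].
  rewrite norm_prod_le/= => /andP[d1 d2].
  have mD : m ^+ 2 <= D t.
    rewrite /m /D prod_normE/= /Order.max; case: ifP => _.
      by rewrite real_normK ?num_real// lerDr sqr_ge0.
    by rewrite real_normK ?num_real// lerDl sqr_ge0.
  apply: (@le_trans _ _ (4 * L * m ^+ 2)); last first.
    by apply: ler_wpM2l => //; exact: mulr_ge0.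
  rewrite /D' !expr1; apply: le_trans (ler_normD _ _) _.
  rewrite !normrM (ger0_norm (ler0n _ 2)).
  have h1 := ler_pM (normr_ge0 _) (normr_ge0 _) d1 F1.
  have h2 := ler_pM (normr_ge0 _) (normr_ge0 _) d2 F2.
  rewrite -!mulrA; have -> : 4 * (L * m ^+ 2) = 2 * (m * (L * m)) + 2 * (m * (L * m)).
    by ring.
  by rewrite lerD// ler_wpM2l.
have DLu t : a <= t <= b -> D' t <= 4 * L * D t.
  by move=> /DL; rewrite ler_norml => /andP[].
have DLl t : a <= t <= b -> - (4 * L * D t) <= D' t.
  by move=> /DL; rewrite ler_norml => /andP[].
case: uv => [e|e]; split => //; apply: Duv.
- exact: gronwall_forward ab dD DLu (uvD _ e).
- exact: gronwall_backward ab dD DLl (uvD _ e).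
Qed.

Lemma solution_unique F q J K u v : locally_lipschitz F ->
  solution F q J u -> solution F q K v -> forall t, J t -> K t -> u t = v t.
Proof.
move=> llF [_ iJ J0 u0 du] [_ iK K0 v0 dv] t Jt Kt.
have [t0|/ltW t0] := leP 0 t.
- have [|||//] := @agree_on_segment F u v 0 t llF t0.
  + by move=> s st; apply: du; exact: iJ J0 Jt _ st.
  + by move=> s st; apply: dv; exact: iK K0 Kt _ st.
  + by left; rewrite u0 v0.
- have [|||//] := @agree_on_segment F u v t 0 llF t0.
  + by move=> s st; apply: du; exact: iJ Jt J0 _ st.
  + by move=> s st; apply: dv; exact: iK Kt K0 _ st.
  + by right; rewrite u0 v0.
Qed.

(** By uniqueness, all solutions starting at [q] agree where their domains overlap, so they glue on
    the union of these domains. *)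
Lemma greatest_solution F q : locally_lipschitz F ->
  (exists K v, solution F q K v) ->
  exists J u, solution F q J u /\
    forall K v, solution F q K v -> K `<=` J /\ (forall t, K t -> u t = v t).
Proof.
move=> llF [K0 [v0 sol0]].
pose J t := exists K v, solution F q K v /\ K t.
have ex_u t : exists z, forall K v, solution F q K v -> K t -> z = v t.
  have [[K [v [sv Kt]]]|nJ] := pselect (J t).
    by exists (v t) => K' v' sv' Kt'; exact: (solution_unique llF sv sv').
  by exists 0 => K v sv Kt; exfalso; apply: nJ; exists K, v.
have [u uP] := choice ex_u.
exists J, u; split; last first.
  move=> K v sv; split => [t Kt|t Kt]; first by exists K, v.
  exact: uP sv Kt.
split.
- rewrite (_ : J = \bigcup_(K in [set K | exists v, solution F q K v]) K).
    by apply: bigcup_open => K [v []].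
  apply/seteqP; split => t.
    by move=> [K [v [sv Kt]]]; exists K => //; exists v.
  by move=> [K [v sv] Kt]; exists K, v.
- move=> x y [K [v [sv Kx]]] [K' [v' [sv' K'y]]] z /andP[xz zy].
  have [_ iK K_0 _ _] := sv; have [_ iK' K'_0 _ _] := sv'.
  (* Every domain contains 0, so a point between [x] and [y] lies in the domain of [x] or of [y]
     according to its sign. *)
  have [z0|/ltW z0] := leP z 0.
    by exists K, v; split => //; apply: iK Kx K_0 _ _; rewrite xz.
  by exists K', v'; split => //; apply: iK' K'_0 K'y _ _; rewrite z0.
- by have [_ _ K00 _ _] := sol0; exists K0, v0.
- by have [_ _ K00 <- _] := sol0; exact: uP sol0 K00.
- move=> t [K [v [sv Kt]]]; have [oK _ _ _ dv] := sv.
  rewrite (uP t _ _ sv Kt); apply: is_derive_near (dv t Kt).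
  by near=> s; apply/esym; apply: uP sv _; near: s; exact: open_nbhs_nbhs.
Unshelve. all: by end_near. Qed.

Lemma exists_maximal_solution F q : locally_lipschitz F ->
  (exists K v, solution F q K v) -> exists J u, maximal_solution F q J u.
Proof.
move=> llF /(greatest_solution llF)[J [u [su Ju]]].
by exists J, u; split => // K v sv _ _; have [] := Ju K v sv.
Qed.

(** Maximality only compares [u] with its own extensions; through the greatest solution it becomes
    comparable with any [v]. This carries what is known of one constructed solution over to all
    maximal ones. *)
Lemma maximal_solution_extends F q J K u v : locally_lipschitz F ->
  maximal_solution F q J u -> solution F q K v ->
  K `<=` J /\ forall t, K t -> u t = v t.
Proof.
move=> llF [su mu] sv.
have [G [w [sw Gw]]] : exists G w, solution F q G w /\ forall K v, solution F q K v ->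
    K `<=` G /\ (forall t, K t -> w t = v t).
  by apply: greatest_solution => //; exists K, v.
have [JG wu] := Gw _ _ su; have [KG wv] := Gw _ _ sv.
have KJ : K `<=` J by apply: subset_trans KG (mu _ _ sw JG wu).
by split => // t Kt; rewrite -wu ?wv//; exact: KJ.
Qed.

End Uniqueness.

(** * Closure properties of locally Lipschitz functions *)

Section LocallyLipschitz.
Context {R : realType}.
Implicit Types (f g : R * R -> R).

Lemma locally_lipschitz_nonneg (V : normedModType R) (F : R * R -> V) (M : R) :
  locally_lipschitz F -> exists2 L : R, 0 < L & forall p q : R * R,
  `|p| <= M -> `|q| <= M -> `|F p - F q| <= L * `|p - q|.
Proof.
move=> /(_ M)[L FL]; exists (`|L| + 1); first by rewrite ltr_pwDr.
move=> p q pM qM; apply: le_trans (FL p q pM qM) _.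
by apply: ler_wpM2r => //; rewrite (le_trans (ler_norm _))// lerDl.
Qed.

Lemma locally_lipschitz_bounded (V : normedModType R) (F : R * R -> V) (M : R) :
  locally_lipschitz F -> exists B : R, forall p : R * R, `|p| <= M -> `|F p| <= B.
Proof.
move=> /(locally_lipschitz_nonneg M)[L L0 FL].
exists (`|F 0| + L * M) => p pM.
have M0 : 0 <= M by exact: le_trans (normr_ge0 p) pM.
have h : `|F p - F 0| <= L * M.
  apply: le_trans (FL p 0 pM _) _; first by rewrite normr0.
  by rewrite subr0 ler_wpM2l// ltW.
by rewrite -[F p](subrK (F 0)) addrC (le_trans (ler_normD _ _))// lerD2l.
Qed.

Lemma locally_lipschitz_continuous (V : normedModType R) (F : R * R -> V) :
  locally_lipschitz F -> continuous F.
Proof.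
move=> llF p; have [L L0 FL] := locally_lipschitz_nonneg (`|p| + 1) llF.
apply/cvgrPdist_lt => e e0; near=> q.
have h1 : `|p - q| < 1 by near: q; exact: (@near_dist_lt _ (R * R)%type p).
have h2 : `|p - q| < e / L.
  by near: q; apply: (@near_dist_lt _ (R * R)%type p); exact: divr_gt0.
apply: le_lt_trans (FL _ _ _ _) _; first by rewrite lerDl.
  rewrite -[q](subKr p) (le_trans (ler_normB _ _))// lerD2l.
  exact: ltW.
by rewrite mulrC -ltr_pdivlMr.
Unshelve. all: by end_near. Qed.

Lemma locally_lipschitz_cst (c : R) : locally_lipschitz (fun _ : R * R => c).
Proof. by move=> M; exists 0 => p q _ _; rewrite subrr normr0 mul0r. Qed.

Lemma locally_lipschitz_fst : locally_lipschitz (fun p : R * R => p.1).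
Proof.
move=> M; exists 1 => p q _ _; rewrite mul1r.
by have := lexx `|p - q|; rewrite norm_prod_le => /andP[].
Qed.

Lemma locally_lipschitz_snd : locally_lipschitz (fun p : R * R => p.2).
Proof.
move=> M; exists 1 => p q _ _; rewrite mul1r.
by have := lexx `|p - q|; rewrite norm_prod_le => /andP[].
Qed.

Lemma locally_lipschitzD f g : locally_lipschitz f -> locally_lipschitz g ->
  locally_lipschitz (fun p => f p + g p).
Proof.
move=> llf llg M; have [L1 f1] := llf M; have [L2 g2] := llg M.
exists (L1 + L2) => p q pM qM.
rewrite opprD addrACA mulrDl (le_trans (ler_normD _ _))// lerD//.
- exact: f1.
- exact: g2.
Qed.

Lemma locally_lipschitzM f g : locally_lipschitz f -> locally_lipschitz g ->
  locally_lipschitz (fun p => f p * g p).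
Proof.
move=> llf llg M.
have [B1 fB] := locally_lipschitz_bounded M llf.
have [B2 gB] := locally_lipschitz_bounded M llg.
have [L1 f1] := llf M; have [L2 g2] := llg M.
exists (B2 * L1 + B1 * L2) => p q pM qM.
have -> : f p * g p - f q * g q = g p * (f p - f q) + f q * (g p - g q) by ring.
rewrite (le_trans (ler_normD _ _))// mulrDl lerD// normrM -mulrA.
- by apply: ler_pM => //; [exact: gB|exact: f1].
- by apply: ler_pM => //; [exact: fB|exact: g2].
Qed.

Lemma locally_lipschitzN f : locally_lipschitz f ->
  locally_lipschitz (fun p => - f p).
Proof.
by move=> llf M; have [L fL] := llf M; exists L => p q pM qM;
  rewrite -opprD normrN fL.
Qed.

Lemma locally_lipschitzX f n : locally_lipschitz f ->
  locally_lipschitz (fun p => f p ^+ n).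
Proof.
move=> llf; elim: n => [|n ih]; first exact: locally_lipschitz_cst.
by under eq_fun do rewrite exprS; exact: locally_lipschitzM.
Qed.

Lemma locally_lipschitz_lip_comp f (phi : R -> R) (k : R) : 0 <= k ->
  (forall x y, `|phi x - phi y| <= k * `|x - y|) ->
  locally_lipschitz f -> locally_lipschitz (fun p => phi (f p)).
Proof.
move=> k0 phik llf M; have [L fL] := llf M; exists (k * L) => p q pM qM.
by apply: le_trans (phik _ _) _; rewrite -mulrA ler_wpM2l// fL.
Qed.

Lemma locally_lipschitz_pair f g : locally_lipschitz f -> locally_lipschitz g ->
  locally_lipschitz (fun p => (f p, g p) : R * R).
Proof.
move=> llf llg M.
have [L1 L10 f1] := locally_lipschitz_nonneg M llf.
have [L2 L20 g2] := locally_lipschitz_nonneg M llg.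
exists (L1 + L2) => p q pM qM; rewrite norm_prod_le/=; apply/andP; split.
- by apply: le_trans (f1 _ _ pM qM) _; rewrite ler_wpM2r// lerDl ltW.
- by apply: le_trans (g2 _ _ pM qM) _; rewrite ler_wpM2r// lerDr ltW.
Qed.

End LocallyLipschitz.

(** * The energy and its coercivity *)

Section Energy.
Context {R : realType}.
Implicit Types (p q : R * R) (theta : R).

(** The primitive of [x * (x ^+ 2 - 1) ^+ 2] that vanishes at 0; with it [energy] is the Hamiltonian
    of the case [theta = 0]. *)
Definition potential (x : R) : R := ((x ^+ 2 - 1) ^+ 3 + 1) / 6.

Definition energy p : R := p.2 ^+ 2 / 2 + potential p.1.

Lemma locally_lipschitz_energy : locally_lipschitz energy.
Proof.
apply: locally_lipschitzD; apply: locally_lipschitzM.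
- exact/locally_lipschitzX/locally_lipschitz_snd.
- exact: locally_lipschitz_cst.
- apply: locally_lipschitzD; last exact: locally_lipschitz_cst.
  apply/locally_lipschitzX/locally_lipschitzD; last exact: locally_lipschitz_cst.
  exact/locally_lipschitzX/locally_lipschitz_fst.
- exact: locally_lipschitz_cst.
Qed.

Lemma locally_lipschitz_system theta : locally_lipschitz (system theta).
Proof.
have llw : locally_lipschitz (fun p : R * R => (p.1 ^+ 2 - 1) ^+ 2).
  apply/locally_lipschitzX/locally_lipschitzD; last exact: locally_lipschitz_cst.
  exact/locally_lipschitzX/locally_lipschitz_fst.
apply: locally_lipschitz_pair; first exact: locally_lipschitz_snd.
apply: locally_lipschitzD; apply: locally_lipschitzM => //.
- exact/locally_lipschitzN/locally_lipschitz_fst.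
- apply: locally_lipschitzM; first exact: locally_lipschitz_cst.
  exact: locally_lipschitz_snd.
Qed.

(** The constant 1/8 is sharp: the difference is a nonnegative product that vanishes at
    [x ^+ 2 = 3 / 2]. The bound is global, so sublevel sets of the energy are bounded. *)
Lemma potential_ge (x : R) : x ^+ 2 / 8 <= potential x.
Proof.
rewrite -subr_ge0 (_ : _ - _ = x ^+ 2 * (2 * x ^+ 2 - 3) ^+ 2 / 24).
  by rewrite divr_ge0// mulr_ge0 ?sqr_ge0.
by rewrite /potential; field.
Qed.

Lemma energy_ge p : `|p| ^+ 2 / 8 <= energy p.
Proof.
have h1 := potential_ge p.1.
have h2 := sqr_ge0 p.1; have h3 := sqr_ge0 p.2.
by rewrite /energy prod_normE/= /Order.max; case: ifP => _;
  rewrite real_normK ?num_real//; lra.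
Qed.

Lemma energy0 : energy (0, 0) = 0.
Proof. by rewrite /energy /potential/=; field. Qed.

Lemma energy_gt0 p : 0 < `|p| -> 0 < energy p.
Proof.
by move=> p0; apply: lt_le_trans (energy_ge p); rewrite divr_gt0// exprn_gt0.
Qed.

Lemma energy_norm_lt p (e : R) : 0 < e -> energy p < e ^+ 2 / 8 -> `|p| < e.
Proof.
move=> e0 pe; rewrite -(@ltr_pXn2r _ 2%N)// ?nnegrE// ?ltW//.
by have := energy_ge p; lra.
Qed.

Lemma is_derive_potential (x : R -> R) (t a : R) : is_derive t (1 : R) x a ->
  is_derive t (1 : R) (fun s => potential (x s)) (x t * (x t ^+ 2 - 1) ^+ 2 * a).
Proof.
move=> dx; have := is_derive_pointM (is_derive_pointD (is_derive_pointX 2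
  (is_derive_pointB (is_derive_pointX 1 dx) (is_derive_pointC t 1)))
  (is_derive_pointC t 1)) (is_derive_pointC t 6^-1).
by congr (is_derive _ _ _ _); field.
Qed.

Lemma is_derive_energy (u : R -> R * R) (t a b : R) :
  is_derive t (1 : R) u (a, b) ->
  is_derive t (1 : R) (fun s => energy (u s))
    ((u t).2 * b + (u t).1 * ((u t).1 ^+ 2 - 1) ^+ 2 * a).
Proof.
move=> /is_derive_prod[/= du1 du2].
have := is_derive_pointD (is_derive_pointM (is_derive_pointX 1 du2)
  (is_derive_pointC t 2^-1)) (is_derive_potential du1).
by congr (is_derive _ _ _ (_ + _)); field.
Qed.

End Energy.

(** * Replacing the field by a bounded, globally Lipschitz one *)

Section Cutoff.
Context {R : realType}.
Implicit Types (p q : R * R) (theta : R).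

Definition clamp (a b x : R) : R := Num.max a (Num.min b x).

Lemma clamp_lip (a b x y : R) : `|clamp a b x - clamp a b y| <= `|x - y|.
Proof.
rewrite /clamp /Num.max /Num.min.
have := ler_norm (x - y); have := ler_norm (y - x); rewrite [`|y - x|]distrC => h1 h2.
have h3 : 0 <= `|x - y| by [].
rewrite ler_norml.
by case: (ltP b x) => ?; case: (ltP b y) => ?; case: ltP => ?; case: ltP => ?; lra.
Qed.

Definition clamp_box p : R * R := (clamp (-1) 1 p.1, clamp (-1) 1 p.2).

Lemma clamp_box_lip p q : `|clamp_box p - clamp_box q| <= `|p - q|.
Proof.
have := lexx `|p - q|; rewrite norm_prod_le => /andP[h1 h2].
rewrite norm_prod_le/=; apply/andP; split.
- exact: le_trans (clamp_lip _ _ _ _) h1.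
- exact: le_trans (clamp_lip _ _ _ _) h2.
Qed.

Lemma clamp11_le (x : R) : `|clamp (-1) 1 x| <= 1.
Proof.
rewrite /clamp /Num.max /Num.min ler_norml.
by case: (ltP 1 x) => ?; case: ltP => ?; lra.
Qed.

Lemma clamp11_id (x : R) : `|x| <= 1 -> clamp (-1) 1 x = x.
Proof.
rewrite /clamp /Num.max /Num.min ler_norml => /andP[? ?].
by case: (ltP 1 x) => ?; case: ltP => ?; lra.
Qed.

Lemma clamp11_out (x : R) : 1 < `|x| -> `|clamp (-1) 1 x| = 1.
Proof.
rewrite /clamp /Num.max /Num.min real_ltr_normr ?num_real// => /orP[x1|x1].
- by rewrite x1; case: ltP => ?; [rewrite normr1|lra].
- by case: (ltP 1 x) => ?; [lra|]; case: ltP => ?; [lra|rewrite normrN1].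
Qed.

Lemma clamp_box_le p : `|clamp_box p| <= 1.
Proof. by rewrite norm_prod_le/= !clamp11_le. Qed.

Lemma clamp_box_id p : `|p| <= 1 -> clamp_box p = p.
Proof.
by rewrite norm_prod_le => /andP[p1 p2]; rewrite /clamp_box !clamp11_id// -surjective_pairing.
Qed.

Lemma clamp_box_out p : 1 < `|p| -> 1 <= `|clamp_box p|.
Proof.
rewrite !prod_normE/= lt_max le_max => /orP[|] /clamp11_out ->; rewrite lexx ?orbT//.
Qed.

(* On the boundary of the unit box the energy is at least 1/8, so a cutoff that
   vanishes from that energy level on makes the clamped field a multiple of the
   original one everywhere; hence the energy stays monotone along its orbits. *)
Lemma cutoff_field (F : R * R -> R * R) : locally_lipschitz F ->
  exists k : R * R -> R, exists L B : R,
    [/\ forall p, 0 <= k p, forall p, energy p <= 1 / 16 -> k p = 1, 0 < L,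
        forall p q, `|k p *: F p - k q *: F q| <= L * `|p - q| &
        forall p, `|k p *: F p| <= B].
Proof.
(* A ramp of slope -16 that descends from 1 at 1/16 to 0 at 1/8. *)
move=> llF; pose chi (s : R) := clamp 0 1 (2 - 16 * s).
have chi_ge0 s : 0 <= chi s by rewrite /chi /clamp le_max lexx.
have chi1 s : s <= 1 / 16 -> chi s = 1.
  by move=> s16; rewrite /chi /clamp /Num.min /Num.max;
    case: (ltP 1 (2 - 16 * s)) => ?; case: ltP => ?; lra.
have chi0 s : 1 / 8 <= s -> chi s = 0.
  by move=> s8; rewrite /chi /clamp /Num.min /Num.max;
    case: (ltP 1 (2 - 16 * s)) => ?; case: ltP => ?; lra.
have chi_lip x y : `|chi x - chi y| <= 16 * `|x - y|.
  apply: le_trans (clamp_lip _ _ _ _) _.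
  rewrite (_ : _ - _ = 16 * (y - x)); last by ring.
  by rewrite normrM distrC ger0_norm.
pose H p := chi (energy p) *: F p.
have llchi : locally_lipschitz (fun p => chi (energy p)).
  by apply: locally_lipschitz_lip_comp chi_lip _ => //; exact: locally_lipschitz_energy.
have ll1 : locally_lipschitz (fun p => (F p).1).
  move=> M; have [L FL] := llF M; exists L => p q pM qM.
  by have := FL p q pM qM; rewrite norm_prod_le => /andP[].
have ll2 : locally_lipschitz (fun p => (F p).2).
  move=> M; have [L FL] := llF M; exists L => p q pM qM.
  by have := FL p q pM qM; rewrite norm_prod_le => /andP[].
have llH : locally_lipschitz H.
  exact: (locally_lipschitz_pair (locally_lipschitzM llchi ll1) (locally_lipschitzM llchi ll2)).
have [L L0 HL] := locally_lipschitz_nonneg 1 llH.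
have [B HB] := locally_lipschitz_bounded 1 llH.
pose k p := chi (energy (clamp_box p)).
(* Outside the box both sides vanish, since clamping leads to a point of norm at least 1. The left
   side is a multiple of [F] at [p] itself, as the energy law requires; the right side inherits
   bounds and Lipschitz constant from the unit box. *)
have kE p : k p *: F p = H (clamp_box p).
  rewrite /H /k; have [p1|p1] := leP `|p| 1; first by rewrite clamp_box_id.
  rewrite chi0 ?scale0r//; apply: le_trans (energy_ge _).
  have := clamp_box_out p1 => h; rewrite ler_wpM2r// ?invr_ge0//.
  by rewrite exprn_ege1.
exists k, L, B; split => //.
- by move=> p; exact: chi_ge0.
- move=> p p16; rewrite /k clamp_box_id ?chi1// ltW//.
  by apply: energy_norm_lt => //; lra.
- move=> p q; rewrite !kE; apply: le_trans (HL _ _ _ _) _; rewrite ?clamp_box_le//.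
  by apply: ler_wpM2l; [exact: ltW|exact: clamp_box_lip].
- by move=> p; rewrite kE; apply: HB; exact: clamp_box_le.
Qed.

End Cutoff.

(** * Global solutions at low energy, and stability *)

Section EnergyTrapping.
Context {R : realType}.
Implicit Types (p q : R * R) (theta : R).

Lemma cutoff_solution theta q : exists (k : R * R -> R) (v : R -> R * R),
  [/\ forall p, 0 <= k p, forall p, energy p <= 1 / 16 -> k p = 1, v 0 = q,
      forall t : R, is_derive t (1 : R) v (k (v t) *: system theta (v t)) &
      forall t : R, is_derive t (1 : R) (fun s => energy (v s))
        (theta * (k (v t) * (v t).2 ^+ 2 * ((v t).1 ^+ 2 - 1) ^+ 2))].
Proof.
have [k [L [B [k0 k1 L0 FL FB]]]] := cutoff_field (locally_lipschitz_system theta).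
have [v [v0 dv]] := lipschitz_global_solution q L0 FL FB.
exists k, v; split => // t.
have := is_derive_energy (dv t : is_derive _ _ _ (_, _)).
by congr (is_derive _ _ _ _) => /=; rewrite /GRing.scale/=; ring.
Qed.

Lemma dissipative_solution theta q : theta <= 0 -> energy q < 1 / 16 ->
  exists K v, solution (system theta) q K v /\
    forall t, 0 <= t -> K t /\ energy (v t) <= energy q.
Proof.
move=> th0 q16; have [k [v [k0 k1 v0 dv dE]]] := cutoff_solution theta q.
have Ev t : 0 <= t -> energy (v t) <= energy q.
  move=> t0; rewrite -v0 -lerN2.
  apply: (@ge0_derive_le R (fun s : R => - energy (v s)) (fun s : R => - (theta *
    (k (v s) * (v s).2 ^+ 2 * ((v s).1 ^+ 2 - 1) ^+ 2)))) => //.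
  move=> s _; rewrite -mulNr; apply: mulr_ge0; first by rewrite oppr_ge0.
  by apply: mulr_ge0; [apply: mulr_ge0; [exact: k0|exact: sqr_ge0]|exact: sqr_ge0].
have cE : {for 0, continuous (fun s : R => energy (v s))}.
  exact: is_derive1_continuous (dE 0).
(* The domain must be open, hence contain negative times, where the energy may exceed that of [q];
   the strict inequality at [q] keeps the cutoff equal to 1 for a short while. *)
have : \forall s \near (0 : R), energy (v s) < 1 / 16.
  by move: cE => /cvgr_lt; rewrite v0; exact.
move=> /nbhs_ballP[e /= e0 eE].
exists `]-e, +oo[%classic, v; split.
  split => //.
  - exact: interval_is_interval.
  - by rewrite /= in_itv/= andbT oppr_lt0.
  - move=> t; rewrite /= in_itv/= andbT => et.
    suff kv : k (v t) = 1 by have := dv t; rewrite kv scale1r.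
    apply: k1; have [t0|t0] := leP 0 t; first by rewrite (le_trans (Ev t t0))// ltW.
    by apply/ltW/eE; rewrite /ball/= sub0r normrN ltr0_norm// ltrNl.
by move=> t t0; split; [rewrite /= in_itv/= andbT (lt_le_trans _ t0)// oppr_lt0|exact: Ev].
Qed.

Lemma conservative_solution q : energy q < 1 / 16 ->
  exists v, solution (system 0) q setT v /\ forall t, energy (v t) = energy q.
Proof.
move=> q16; have [k [v [k0 k1 v0 dv dE]]] := cutoff_solution 0 q.
have Ev t : energy (v t) = energy q.
  rewrite -v0; apply: (@is_derive_0_is_cst R (fun s => energy (v s))) => s.
  by have := dE s; rewrite mul0r.
exists v; split => //; split => //.
- exact: openT.
- move=> t _; suff kv : k (v t) = 1 by have := dv t; rewrite kv scale1r.
  by apply: k1; rewrite Ev ltW.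
Qed.

Lemma near0_energy_lt (e : R) : 0 < e ->
  \forall q \near ((0, 0) : R * R), energy q < e.
Proof.
move=> e0.
have := @locally_lipschitz_continuous _ _ _ locally_lipschitz_energy ((0, 0) : R * R).
by move=> /cvgr_lt; rewrite energy0; exact.
Qed.

Lemma equilibrium_system theta : equilibrium (system theta) (0, 0).
Proof. by rewrite /equilibrium /system/= mulr0 oppr0 !mul0r addr0. Qed.

Lemma stable_system theta : theta < 0 -> stable (system theta) (0, 0).
Proof.
move=> th0; split; first exact: equilibrium_system.
move=> U /nbhs_ballP[e /= e0 eU].
exists [set q | energy q < 1 / 16 /\ energy q < e ^+ 2 / 8].
  have h1 : (0 : R) < 1 / 16 by [].
  have h2 : 0 < e ^+ 2 / 8 by rewrite divr_gt0// exprn_gt0.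
  by apply: filterI; exact: near0_energy_lt.
move=> q [q16 qe]; have [K [v [sv Kv]]] := dissipative_solution (ltW th0) q16.
split.
  by apply: exists_maximal_solution; [exact: locally_lipschitz_system|exists K, v].
move=> J u mu t t0.
have [KJ uv] := maximal_solution_extends (locally_lipschitz_system theta) mu sv.
have [Kt Et] := Kv t t0; split; first exact: KJ.
rewrite uv//; apply: eU; rewrite -ball_normE /ball_/= sub0r normrN.
by apply: energy_norm_lt => //; exact: le_lt_trans Et qe.
Qed.

End EnergyTrapping.

(** * Instability by a Chetaev function *)

Section Instability.
Context {R : realType}.
Implicit Types (p q : R * R) (theta : R).

(* The energy alone does not grow on the axis [y = 0]; the term [- e x y] makes
   the growth rate positive there too. *)
Definition chetaev (e : R) p : R := 2 * energy p - e * p.1 * p.2.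

Definition chetaev_deriv (e theta : R) p : R :=
  2 * (theta * p.2 ^+ 2 * (p.1 ^+ 2 - 1) ^+ 2) -
  e * (p.2 * p.2 + p.1 * (system theta p).2).

Lemma is_derive_chetaev (u : R -> R * R) (e theta t : R) :
  is_derive t (1 : R) u (system theta (u t)) ->
  is_derive t (1 : R) (fun s => chetaev e (u s)) (chetaev_deriv e theta (u t)).
Proof.
move=> du; have /is_derive_prod[/= du1 du2] := du.
have := is_derive_pointB
  (is_derive_pointM (is_derive_pointC t 2) (is_derive_energy (du : is_derive _ _ _ (_, _))))
  (is_derive_pointM (is_derive_pointM (is_derive_pointC t e) du1) du2).
by congr (is_derive _ _ _ _); rewrite /chetaev_deriv /=; ring.
Qed.

(** The choice of [e] means [e * (1 + theta ^+ 2) = theta / 2]. The energy term gives at least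
    [theta * y ^+ 2]; half of it pays for [e * y ^+ 2] and for the [y] part of the mixed term, split
    by Young's inequality. The [x] part of that split takes [e * x ^+ 2 / 4] out of
    [e * x ^+ 2 / 2]. *)
Lemma chetaev_deriv_ge (theta e : R) p : 0 < theta ->
  e = theta / (2 * (1 + theta ^+ 2)) -> `|p| <= 1 / 4 ->
  e / 4 * (p.1 ^+ 2 + p.2 ^+ 2) <= chetaev_deriv e theta p.
Proof.
case: p => x y th0 e_def; rewrite norm_prod_le/= => /andP[xb yb].
have T0 : 0 < 1 + theta ^+ 2 by rewrite ltr_wpDr ?sqr_ge0.
have e0 : 0 < e by rewrite e_def divr_gt0// mulr_gt0.
have eE : 2 * e * (1 + theta ^+ 2) = theta.
  rewrite e_def; field; exact: lt0r_neq0.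
have x2 : x ^+ 2 <= 1 / 16.
  by rewrite -real_normK ?num_real//; have := normr_ge0 x; nra.
pose w := (x ^+ 2 - 1) ^+ 2.
have x20 := sqr_ge0 x; have y20 := sqr_ge0 y.
have w1 : w <= 1 by rewrite /w; nra.
have w2 : 1 / 2 <= w by rewrite /w; nra.
have cross : w * (theta * x * y) <= x ^+ 2 / 4 + theta ^+ 2 * y ^+ 2.
  have h1 : theta * x * y <= x ^+ 2 / 4 + theta ^+ 2 * y ^+ 2.
    rewrite -subr_ge0 (_ : _ - _ = (x / 2 - theta * y) ^+ 2) ?sqr_ge0//.
    by field.
  have h2 : 0 <= x ^+ 2 / 4 + theta ^+ 2 * y ^+ 2.
    by rewrite addr_ge0// ?divr_ge0// mulr_ge0// sqr_ge0.
  nra.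
have -> : chetaev_deriv e theta (x, y) =
    2 * theta * w * y ^+ 2 - e * y ^+ 2 + e * w * x ^+ 2 - e * (w * (theta * x * y)).
  by rewrite /chetaev_deriv /system/= /w; ring.
have h1 : theta * y ^+ 2 <= 2 * theta * w * y ^+ 2.
  by apply: ler_wpM2r => //; nra.
have h2 : e * (w * (theta * x * y)) <= e * (x ^+ 2 / 4 + theta ^+ 2 * y ^+ 2).
  by apply: ler_wpM2l => //; exact: ltW.
have h3 : e * x ^+ 2 / 2 <= e * w * x ^+ 2.
  have : e * (x ^+ 2 * (1 / 2)) <= e * (x ^+ 2 * w).
    by apply: ler_wpM2l; [exact: ltW|exact: ler_wpM2l].
  lra.
have h4 : e * y ^+ 2 + e * (theta ^+ 2 * y ^+ 2) = theta * y ^+ 2 / 2.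
  by rewrite -{2}eE; field.
have h5 : e * y ^+ 2 <= theta * y ^+ 2 / 2.
  by rewrite -h4 lerDl mulr_ge0 ?(ltW e0)// mulr_ge0// sqr_ge0.
have h6 : 0 <= e * y ^+ 2 by rewrite mulr_ge0// ltW.
lra.
Qed.

(** Combined with [chetaev_deriv_ge], this bounds the growth rate below: the derivative is at least
    [e / 8] times the function. *)
Lemma chetaev_le (theta e : R) p : 0 < theta ->
  e = theta / (2 * (1 + theta ^+ 2)) -> `|p| <= 1 / 4 ->
  chetaev e p <= 2 * (p.1 ^+ 2 + p.2 ^+ 2).
Proof.
case: p => x y th0 e_def; rewrite norm_prod_le/= => /andP[xb yb].
have T0 : 0 < 1 + theta ^+ 2 by rewrite ltr_wpDr ?sqr_ge0.
have e0 : 0 < e by rewrite e_def divr_gt0// mulr_gt0.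
have e1 : e <= 1.
  rewrite e_def ler_pdivrMr ?mulr_gt0// mul1r.
  by have := sqr_ge0 (theta - 1); have := sqr_ge0 theta; lra.
have x2 : x ^+ 2 <= 1 / 16.
  by rewrite -real_normK ?num_real//; have := normr_ge0 x; nra.
have x20 := sqr_ge0 x; have y20 := sqr_ge0 y.
have pot : 2 * potential x <= 3 / 2 * x ^+ 2.
  rewrite -subr_ge0 (_ : _ - _ = x ^+ 2 * (3 / 2 - (x ^+ 2 * x ^+ 2 - 3 * x ^+ 2 + 3) / 3)).
    by rewrite mulr_ge0//; nra.
  by rewrite /potential; field.
have cross : - (e * x * y) <= (x ^+ 2 + y ^+ 2) / 2.
  have h1 : - (x * y) <= (x ^+ 2 + y ^+ 2) / 2.
    rewrite -subr_ge0 (_ : _ - _ = (x + y) ^+ 2 / 2) ?divr_ge0 ?sqr_ge0//.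
    by field.
  have h2 : 0 <= (x ^+ 2 + y ^+ 2) / 2 by rewrite divr_ge0// addr_ge0.
  have : e * - (x * y) <= e * ((x ^+ 2 + y ^+ 2) / 2).
    by apply: ler_wpM2l => //; exact: ltW.
  have : e * ((x ^+ 2 + y ^+ 2) / 2) <= 1 * ((x ^+ 2 + y ^+ 2) / 2).
    exact: ler_wpM2r.
  rewrite mulrN mulrA; lra.
rewrite /chetaev /energy/=; lra.
Qed.

Lemma unstable_system theta : 0 < theta -> unstable (system theta) (0, 0).
Proof.
move=> th0; split; first exact: equilibrium_system.
move=> [_ /(_ (ball (0, 0) (1 / 4)))[]]; first by apply: nbhsx_ballx.
move=> V /nbhs_ballP[r /= r0 rV] Vstays.
(* At [(0, s)] the potential and the mixed term vanish, so the Chetaev function has the positive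
   value [s ^+ 2]. *)
pose s := r / 2; have s0 : 0 < s by rewrite divr_gt0.
have [|[J [u mu]] /(_ J u mu) uU] := Vstays (0, s).
  apply: rV; rewrite -ball_normE /ball_/= sub0r normrN norm_prod_lt/= normr0 r0/=.
  by rewrite gtr0_norm// /s; lra.
have [[_ _ _ u0 du] _] := mu.
have uB t : 0 <= t -> `|u t| <= 1 / 4.
  move=> /uU[_]; rewrite -ball_normE /ball_/= sub0r normrN; exact: ltW.
pose e := theta / (2 * (1 + theta ^+ 2)).
have T0 : 0 < 1 + theta ^+ 2 by rewrite ltr_wpDr ?sqr_ge0.
have e0 : 0 < e by rewrite divr_gt0// mulr_gt0.
pose W (t : R) := chetaev e (u t).
have dW (t : R) : 0 <= t -> is_derive t (1 : R) W (chetaev_deriv e theta (u t)).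
  by move=> /uU[Jt _]; apply: is_derive_chetaev; exact: du.
have W'ge (t : R) : 0 <= t ->
    e / 4 * ((u t).1 ^+ 2 + (u t).2 ^+ 2) <= chetaev_deriv e theta (u t).
  by move=> /uB; exact: chetaev_deriv_ge th0 erefl.
have Wle (t : R) : 0 <= t -> W t <= 2 * ((u t).1 ^+ 2 + (u t).2 ^+ 2).
  by move=> /uB; exact: chetaev_le th0 erefl.
have W0 : W 0 = s ^+ 2.
  by rewrite /W u0 /chetaev /energy /potential/=; field.
have Wge (t : R) : 0 <= t -> s ^+ 2 <= W t.
  move=> t0; rewrite -W0.
  apply: (@ge0_derive_le R W (fun t => chetaev_deriv e theta (u t))) => //.
    by move=> x /andP[x0 _]; exact: dW.
  move=> x /andP[x0 _]; apply: le_trans (W'ge x x0).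
  by rewrite mulr_ge0 ?addr_ge0 ?sqr_ge0// divr_ge0// ltW.
(* Linear growth suffices: the derivative of [W] stays at least [m], so [W] gains at least 1 by time
   [m^-1], whereas it is at most 1/4 in the ball. *)
pose m := e / 8 * s ^+ 2; have m0 : 0 < m by rewrite mulr_gt0 ?exprn_gt0// divr_gt0.
have T_ge0 : 0 <= m^-1 by rewrite invr_ge0 ltW.
have : W 0 - m * 0 <= W m^-1 - m * m^-1.
  apply: (@ge0_derive_le R (fun t => W t - m * t)
    (fun t => chetaev_deriv e theta (u t) - m)) => // x /andP[x0 _].
    apply: is_derive_pointB; first exact: dW.
    have := is_derive_pointM (is_derive_pointC x m) (is_derive_id x (1 : R)).
    by rewrite mul0r add0r mulr1.
  rewrite subr_ge0; apply: le_trans (W'ge x x0).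
  have := le_trans (Wge x x0) (Wle x x0).
  rewrite -(ler_pM2l e0) /m => h; lra.
rewrite divff ?gt_eqF// W0 mulr0 subr0.
have := Wle _ T_ge0; have := uB _ T_ge0; rewrite norm_prod_le => /andP[u1 u2].
have : (u m^-1).1 ^+ 2 <= 1 / 16.
  by rewrite -real_normK ?num_real//; have := normr_ge0 (u m^-1).1; nra.
have : (u m^-1).2 ^+ 2 <= 1 / 16.
  by rewrite -real_normK ?num_real//; have := normr_ge0 (u m^-1).2; nra.
have := sqr_ge0 s; lra.
Qed.

End Instability.

(** * The conservative case: periodic orbits around the origin *)

Section Center.
Context {R : realType}.
Implicit Types (p q : R * R) (u : R -> R * R) (x y t : R).

(* Chosen so that [potential x = x ^ 2 * root_radicand x / 2]; hence
   [potential_root] is a smooth square root of [2 * potential]. *)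
Definition root_radicand x : R := (x ^+ 4 - 3 * x ^+ 2 + 3) / 3.

Lemma root_radicand_gt0 x : 0 < root_radicand x.
Proof.
rewrite divr_gt0// (_ : _ + _ = (x ^+ 2 - 3 / 2) ^+ 2 + 3 / 4); last by field.
by rewrite ltr_wpDl ?sqr_ge0// divr_gt0.
Qed.

Definition potential_root_factor x : R := Num.sqrt (root_radicand x).

Definition potential_root x : R := x * potential_root_factor x.

(** The derivative of [potential_root]: differentiating its square [2 * potential] gives
    [x * (x ^+ 2 - 1) ^+ 2 / potential_root x], and cancelling [x] removes the singularity at 0. *)
Definition angular_speed x : R := (x ^+ 2 - 1) ^+ 2 / potential_root_factor x.

Lemma potential_root_factor_gt0 x : 0 < potential_root_factor x.
Proof. by rewrite sqrtr_gt0 root_radicand_gt0. Qed.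

Lemma sqr_potential_root_factor x :
  potential_root_factor x ^+ 2 = (x ^+ 4 - 3 * x ^+ 2 + 3) / 3.
Proof. by rewrite sqr_sqrtr// ltW// root_radicand_gt0. Qed.

Lemma sqr_potential_root x : potential_root x ^+ 2 = 2 * potential x.
Proof.
by rewrite exprMn sqr_potential_root_factor /potential; field.
Qed.

(** The derivative vanishes at 1 and -1, so the argument is algebraic: equal values have equal
    squares, cubes are injective, hence [x ^+ 2 = y ^+ 2]; the positive factors then coincide and
    cancel. *)
Lemma potential_root_inj : injective potential_root.
Proof.
move=> x y xy.
have sq : x ^+ 2 = y ^+ 2.
  have : (x ^+ 2 - 1) ^+ 3 = (y ^+ 2 - 1) ^+ 3.
    have := sqr_potential_root x; rewrite xy sqr_potential_root /potential; lra.
  move=> h; apply/eqP; rewrite -subr_eq0.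
  have /eqP : (x ^+ 2 - y ^+ 2) * ((x ^+ 2 - 1) ^+ 2 +
      (x ^+ 2 - 1) * (y ^+ 2 - 1) + (y ^+ 2 - 1) ^+ 2) = 0.
    by transitivity ((x ^+ 2 - 1) ^+ 3 - (y ^+ 2 - 1) ^+ 3); [ring|rewrite h subrr].
  rewrite mulf_eq0 => /orP[//|/eqP h0].
  (* Twice the quadratic factor is the sum of these three squares, so each of them is zero. *)
  have h1 := sqr_ge0 (x ^+ 2 - 1 + (y ^+ 2 - 1)).
  have h2 := sqr_ge0 (x ^+ 2 - 1); have h3 := sqr_ge0 (y ^+ 2 - 1).
  have /eqP : (x ^+ 2 - 1) ^+ 2 = 0 by nra.
  have /eqP : (y ^+ 2 - 1) ^+ 2 = 0 by nra.
  by rewrite !sqrf_eq0 !subr_eq0 => /eqP -> /eqP ->.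
have xy4 : x ^+ 4 = y ^+ 4 by rewrite (exprM x 2 2) (exprM y 2 2) sq.
move: xy; rewrite /potential_root /potential_root_factor /root_radicand xy4 sq.
exact/mulIf/lt0r_neq0/potential_root_factor_gt0.
Qed.

Lemma is_derive_potential_root_factor x :
  is_derive x (1 : R) potential_root_factor
    ((2 * x ^+ 3 - 3 * x) / (3 * potential_root_factor x)).
Proof.
have di := is_derive_id x (1 : R).
have dr : is_derive x (1 : R) root_radicand ((4 * x ^+ 3 - 6 * x) / 3).
  have := is_derive_pointM (is_derive_pointD (is_derive_pointB (is_derive_pointX 3 di)
    (is_derive_pointM (is_derive_pointC x 3) (is_derive_pointX 1 di)))
    (is_derive_pointC x 3)) (is_derive_pointC x 3^-1).
  by congr (is_derive _ _ _ _) => /=; field.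
have ds := is_derive1_sqrt (root_radicand_gt0 x).
have := is_derive1_comp ds dr.
rewrite -/(potential_root_factor x).
congr (is_derive _ _ _ _); field.
exact/lt0r_neq0/potential_root_factor_gt0.
Qed.

Lemma is_derive_potential_root x :
  is_derive x (1 : R) potential_root (angular_speed x).
Proof.
have := is_derive_pointM (is_derive_id x (1 : R)) (is_derive_potential_root_factor x).
have k0 := lt0r_neq0 (potential_root_factor_gt0 x).
congr (is_derive _ _ _ _); rewrite /angular_speed/= mul1r.
apply: (mulIf k0); rewrite mulrDl -expr2 sqr_potential_root_factor divfK//.
by field.
Qed.

Lemma angular_speed_ge x : x ^+ 2 <= 1 / 2 -> 1 / 8 <= angular_speed x.
Proof.
move=> x2; have x20 := sqr_ge0 x; have k0 := potential_root_factor_gt0 x.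
rewrite ler_pdivlMr//.
have w : 1 / 4 <= (x ^+ 2 - 1) ^+ 2 by nra.
have k2 : potential_root_factor x ^+ 2 <= 4.
  by rewrite sqr_potential_root_factor (exprM x 2 2); nra.
have : potential_root_factor x <= 2 by nra.
lra.
Qed.

(** Turning [(a, b)] back by the angle [phi] gives a vector with zero derivative; [EA] and [EB] are
    its two coordinates. *)
Lemma rotation_solution (a b phi omega : R -> R) :
  phi 0 = 0 ->
  (forall t : R, is_derive t (1 : R) phi (omega t)) ->
  (forall t : R, is_derive t (1 : R) a (omega t * b t)) ->
  (forall t : R, is_derive t (1 : R) b (- omega t * a t)) ->
  forall t, a t = a 0 * cos (phi t) + b 0 * sin (phi t) /\
            b t = - a 0 * sin (phi t) + b 0 * cos (phi t).
Proof.
move=> phi0 dphi da db t.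
have dc (s : R) : is_derive s (1 : R) (fun s => cos (phi s)) (- sin (phi s) * omega s).
  exact: is_derive1_comp (is_derive_cos _) (dphi s).
have ds (s : R) : is_derive s (1 : R) (fun s => sin (phi s)) (cos (phi s) * omega s).
  exact: is_derive1_comp (is_derive_sin _) (dphi s).
have EA : a t * cos (phi t) - b t * sin (phi t) = a 0.
  apply: (etrans (@is_derive_0_is_cst R
    (fun s => a s * cos (phi s) - b s * sin (phi s)) t 0 _)); last first.
    by rewrite /= phi0 cos0 sin0 mulr1 mulr0 subr0.
  move=> s; have := is_derive_pointB (is_derive_pointM (da s) (dc s))
    (is_derive_pointM (db s) (ds s)).
  by congr (is_derive _ _ _ _); ring.
have EB : a t * sin (phi t) + b t * cos (phi t) = b 0.
  apply: (etrans (@is_derive_0_is_cst R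
    (fun s => a s * sin (phi s) + b s * cos (phi s)) t 0 _)); last first.
    by rewrite /= phi0 cos0 sin0 mulr0 mulr1 add0r.
  move=> s; have := is_derive_pointD (is_derive_pointM (da s) (ds s))
    (is_derive_pointM (db s) (dc s)).
  by congr (is_derive _ _ _ _); ring.
have cs := cos2Dsin2 (phi t).
rewrite -EA -EB; split.
- by rewrite -[LHS]mulr1 -cs; ring.
- by rewrite -[LHS]mulr1 -cs; ring.
Qed.

(** Growth at rate at least [m] brackets the solution between 0 and [alpha / m]. The sign clause
    later makes the period positive. *)
Lemma derive_ge_surjective (phi omega : R -> R) (m : R) : 0 < m -> phi 0 = 0 ->
  (forall t : R, is_derive t (1 : R) phi (omega t)) ->
  (forall t, m <= omega t) ->
  forall alpha, exists2 t, phi t = alpha & (0 < alpha -> 0 < t).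
Proof.
move=> m0 phi0 dphi mo alpha.
have cphi : continuous phi by move=> t; exact: is_derive1_continuous (dphi t).
have growth (a b : R) : a <= b -> m * (b - a) <= phi b - phi a.
  move=> ab; rewrite -subr_ge0.
  suff : phi a - m * a <= phi b - m * b by lra.
  apply: (@ge0_derive_le R (fun s => phi s - m * s) (fun s => omega s - m)) => // t _.
    apply: is_derive_pointB.
    have := is_derive_pointM (is_derive_pointC t m) (is_derive_id t (1 : R)).
    by rewrite mul0r add0r mulr1.
  by rewrite subr_ge0.
have mK : m * (alpha / m) = alpha by rewrite mulrC divfK// gt_eqF.
have [a0|a0] := leP 0 alpha.
- have t0 : 0 <= alpha / m by rewrite divr_ge0// ltW.
  have h := growth _ _ t0; rewrite subr0 phi0 subr0 mK in h.
  have [||c] := @IVT R phi 0 (alpha / m) alpha t0.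
  + exact: continuous_subspaceT.
  + by rewrite phi0 ge_min a0 le_max h orbT.
  + rewrite in_itv/= => /andP[c0 _] phic; exists c => // alpha0.
    rewrite lt_neqAle c0 andbT; apply/negP => /eqP c0'.
    by move: alpha0; rewrite -phic -c0' phi0 ltxx.
- have t0 : alpha / m <= 0 by rewrite pmulr_lle0 ?invr_gt0// ltW.
  have h := growth _ _ t0; rewrite sub0r phi0 sub0r mulrN mK lerN2 in h.
  have [||c] := @IVT R phi (alpha / m) 0 alpha t0.
  + exact: continuous_subspaceT.
  + by rewrite phi0 ge_min h le_max (ltW a0) orbT.
  + by move=> _ phic; exists c => // alpha0; have := lt_trans alpha0 a0; rewrite ltxx.
Qed.

Lemma exists_angle x y : x ^+ 2 + y ^+ 2 = 1 -> exists alpha, cos alpha = x /\ sin alpha = y.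
Proof.
move=> xy; have x1 : -1 <= x <= 1.
  by have := sqr_ge0 y; have := sqr_ge0 x; move=> ? ?; apply/andP; split; nra.
have y2 : 1 - x ^+ 2 = y ^+ 2 by lra.
have [y0|y0] := leP 0 y.
- exists (acos x); rewrite acosK ?sin_acos ?in_itv//; split => //.
  by rewrite y2 sqrtr_sqr ger0_norm.
- exists (- acos x); rewrite cosN sinN acosK ?sin_acos ?in_itv//; split => //.
  by rewrite y2 sqrtr_sqr ltr0_norm// opprK.
Qed.

Lemma rotation_onto (a b x y : R) : x ^+ 2 + y ^+ 2 = a ^+ 2 + b ^+ 2 ->
  0 < a ^+ 2 + b ^+ 2 -> exists alpha, a * cos alpha + b * sin alpha = x /\
    - a * sin alpha + b * cos alpha = y.
Proof.
move=> xy /lt0r_neq0 r0.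
(* These are the cosine and sine solving the linear system by Cramer's rule; their squares add up to
   1 by the two-square identity. *)
have [|alpha [ca sa]] := @exists_angle ((a * x + b * y) / (a ^+ 2 + b ^+ 2))
    ((b * x - a * y) / (a ^+ 2 + b ^+ 2)); last first.
  by exists alpha; rewrite ca sa; split; field.
rewrite !expr_div_n -mulrDl.
rewrite (_ : (a * x + _) ^+ 2 + _ = (a ^+ 2 + b ^+ 2) * (x ^+ 2 + y ^+ 2)); last by ring.
by rewrite xy -expr2 divff// expf_neq0.
Qed.

Lemma energyE p : 2 * energy p = potential_root p.1 ^+ 2 + p.2 ^+ 2.
Proof. by rewrite sqr_potential_root /energy; field. Qed.

(* In the coordinates [(potential_root x, y)] the orbit rotates on a circle with
   angular speed bounded below, so it runs through the whole energy level. *)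
Lemma conservative_orbit u :
  (forall t : R, is_derive t (1 : R) u (system 0 (u t))) ->
  (forall t, energy (u t) = energy (u 0)) ->
  0 < energy (u 0) -> energy (u 0) <= 1 / 16 ->
  (forall p, energy p = energy (u 0) -> exists t, u t = p) /\
  (exists2 T, 0 < T & u T = u 0).
Proof.
move=> du Eu E0 E16.
have du1 (t : R) : is_derive t (1 : R) (fun s => (u s).1) (u t).2.
  by have /is_derive_prod[] := du t.
have du2 (t : R) : is_derive t (1 : R) (fun s => (u s).2) (- (u t).1 * ((u t).1 ^+ 2 - 1) ^+ 2).
  have /is_derive_prod[_] := du t.
  by congr (is_derive _ _ _ _); rewrite /system/= !mul0r addr0.
pose a t := potential_root (u t).1; pose b t := (u t).2.
pose omega t := angular_speed (u t).1.
have comega : continuous omega.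
  move=> t; have dk := is_derive1_comp (is_derive_potential_root_factor (u t).1) (du1 t).
  have k0 := lt0r_neq0 (potential_root_factor_gt0 (u t).1).
  have dw := is_derive_pointX 1 (is_derive_pointB (is_derive_pointX 1 (du1 t))
    (is_derive_pointC t 1)).
  have dV := @is_deriveV R (fun s => potential_root_factor (u s).1) _ _ _ k0 dk.
  have dom := is_derive_pointM dw dV.
  exact: (is_derive1_continuous dom).
have [phi [phi0 dphi]] := continuous_antiderivative comega.
have da (t : R) : is_derive t (1 : R) a (omega t * b t).
  exact: is_derive1_comp (is_derive_potential_root _) (du1 t).
have db (t : R) : is_derive t (1 : R) b (- omega t * a t).
  have := du2 t; congr (is_derive _ _ _ _).
  rewrite /omega /a /potential_root /angular_speed; field.
  exact/lt0r_neq0/potential_root_factor_gt0.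
have rot := rotation_solution phi0 dphi da db.
(* Conservation of energy and [potential_ge] confine the orbit to [x ^+ 2 <= 1 / 2]. *)
have omega_ge t : 1 / 8 <= omega t.
  apply: angular_speed_ge; have := potential_ge (u t).1; have := sqr_ge0 (u t).2.
  by have := Eu t; rewrite /energy => h1 h2 h3; rewrite /energy in E16; lra.
have surj := derive_ge_surjective (divr_gt0 ltr01 (ltr0Sn R 7)) phi0 dphi omega_ge.
have uE t p : a t = potential_root p.1 -> b t = p.2 -> u t = p.
  move=> /potential_root_inj e1 e2.
  by rewrite (surjective_pairing (u t)) e1 -/(b t) e2 -surjective_pairing.
split.
- move=> p Ep.
  have [||alpha [ca sa]] := @rotation_onto (a 0) (b 0) (potential_root p.1) p.2.
  + by rewrite -!energyE Ep.
  + by rewrite -energyE mulr_gt0.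
  have [t phit _] := surj alpha; exists t.
  by have [ea eb] := rot t; apply: uE; rewrite ?ea ?eb phit.
- have [T phiT T0] := surj (pi *+ 2); exists T.
    by apply: T0; rewrite pmulrn_lgt0// pi_gt0.
  have [ea eb] := rot T; apply: uE.
  + by rewrite ea phiT cos2pi sin2pi mulr1 mulr0 addr0.
  + by rewrite eb phiT cos2pi sin2pi mulr1 mulr0 add0r.
Qed.

Lemma energy_level_encloses (C : set (R * R)) (c : R) : 0 < c <= 1 / 16 ->
  C = [set p | energy p = c] -> encloses C (0, 0).
Proof.
move=> /andP[c0 c16] CE.
have nC0 : ~ C (0, 0) by rewrite CE/= energy0 => e; move: c0; rewrite -e ltxx.
split => //.
set A := connected_component _ _.
have A0 : A (0, 0) by exact: connected_component_refl.
(* The image is an interval that contains 0 and omits [c], so it stays below [c]. *)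
have cE : connected (energy @` A).
  apply: connected_continuous_connected; first exact: component_connected.
  exact/continuous_subspaceT/locally_lipschitz_continuous/locally_lipschitz_energy.
have Alt p : A p -> energy p < c.
  move=> Ap; rewrite ltNge; apply/negP => cp.
  have [] : (energy @` A) c.
    have iE := (connected_intervalP _).1 cE.
    apply: (iE (energy (0, 0)) (energy p)).
    - by exists (0, 0).
    - by exists p.
    - by rewrite energy0 ltW.
  by move=> z /connected_component_sub/= nCz zc; apply: nCz; rewrite CE.
exists 1; split; first exact: num_real.
move=> M M1 p /Alt pc; apply: le_trans (ltW M1); apply/ltW.
by apply: energy_norm_lt => //; lra.
Qed.

Lemma center_system : center_equilibrium (@system R 0) (0, 0).
Proof.
split; first exact: equilibrium_system.
have [r /= r0 rE] : exists2 r, 0 < r & forall q, `|q| < r -> energy q < 1 / 16.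
  have /nbhs_ballP[r r0 rE] := near0_energy_lt (divr_gt0 ltr01 (ltr0Sn R 15)).
  exists r => // q qr; apply: rE.
  by rewrite -ball_normE /ball_/= sub0r normrN.
exists r => // q; rewrite (_ : q - (0, 0) = q); last exact: subr0.
move=> /andP[q0 /rE q16].
have llF := @locally_lipschitz_system R 0.
have [v [sv Ev]] := conservative_solution q16.
split; first by apply: exists_maximal_solution => //; exists setT, v.
move=> J u mu.
have [JT uv] := maximal_solution_extends llF mu sv.
have JE : J = setT by apply/seteqP; split.
have {uv} uv : u = v by apply/funext => t; exact: uv.
subst u; have [_ _ _ v0 dv] := sv.
have {}dv (t : R) : is_derive t (1 : R) v (system 0 (v t)) by exact: dv.
have Ev0 : energy (v 0) = energy q by rewrite v0.
have Eq0 := energy_gt0 q0.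
have [onto [T T0 vT]] : (forall p, energy p = energy (v 0) -> exists t, v t = p) /\
    (exists2 T, 0 < T & v T = v 0).
  by apply: conservative_orbit => //; rewrite ?Ev0//; exact: ltW.
split.
- split => //.
  (* The antipode of [q] has the same energy, so the orbit visits it and is not constant. *)
  + have [|t vt] := onto (- q.1, - q.2).
      by rewrite v0 /energy /potential/= !sqrrN.
    exists t; rewrite vt v0; apply/eqP => qE.
    have /(congr1 fst)/= h1 := qE; have /(congr1 snd)/= h2 := qE.
    have q1 : q.1 = 0 by lra.
    have q2 : q.2 = 0 by lra.
    by move: Eq0; rewrite (surjective_pairing q) q1 q2 energy0 ltxx.
  + exists T => // t.
    (* A single return to [q] yields periodicity: the shifted solution solves the same initial value
       problem. *)
    have sw : solution (system 0) q setT (fun s => v (s + T)).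
      split => //; first exact: openT.
      - by rewrite add0r vT v0.
      - by move=> s _; exact: is_derive_timeD.
    exact: (solution_unique llF sw sv).
- apply: (@energy_level_encloses _ (energy q)); first by rewrite Eq0 ltW.
  apply/seteqP; split => [_ [t _ <-]|p /= pq]; first exact: Ev.
  by have [|t <-] := onto p; [rewrite Ev0|exists t].
Qed.

End Center.

Theorem theorem2p1 (R : realType) (theta : R) :
  equilibrium (system theta) (0, 0) /\
  (theta < 0 -> stable (system theta) (0, 0)) /\
  (0 < theta -> unstable (system theta) (0, 0)) /\
  (theta = 0 -> center_equilibrium (system theta) (0, 0)).
Proof.
split; first exact: equilibrium_system.
split; first exact: stable_system.
split; first exact: unstable_system.
by move=> ->; exact: center_system.
Qed.
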